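(* Let $\alpha\in(0,1]$, $\eta,\sigma>0$, $a=-\eta/\sigma$, $b=\eta/\sigma$, let $X^+$ be the reflected Brownian motion on $[a,b]$ with $X^+_0\in\{a,b\}$, let $H$ be an $\alpha$-stable subordinator independent of $X^+$, and let $\bar X$ be the associated sticky Brownian motion. With $\theta^*_j,e^L_j,T^L_j,N^L_t,\bar\gamma,\bar r$ as defined in the context, the following identity holds pathwise (almost surely), for all $t\ge0$: $$\bar\gamma_{\bar r_t}(a)-\bar\gamma_{\bar r_t}(b)=\sum_{j=1}^{N^L_t}\theta^*_j e^L_j+\theta^*_{N^L_t+1}\,\big(t-T^L_{N^L_t}\big).$$
   Context: Reflected Brownian motion and local times. $X^+=\{X^+_t\}_{t\ge0}$ is the reflected Brownian motion on $[a,b]$ (generator $\varphi''$), satisfying the Skorokhod decomposition $$X^+_t=X^+_0+B_t+\gamma^+_t(a)-\gamma^+_t(b),$$ where $B$ is a Brownian motion with variance $2t$ and $\gamma^+_t(a)$, $\gamma^+_t(b)$ are the continuous non-decreasing boundary local times at $a$ and $b$ (started at $0$, increasing only when $X^+$ is at $a$, respectively at $b$). The total boundary local time is $\gamma^+_t=\gamma^+_t(a)+\gamma^+_t(b)$. The midpoint of $[a,b]$ is $0$. Sticky Brownian motion. $H$ satisfies $\mathbf{E}[e^{-\lambda H_t}]=e^{-t\lambda^\alpha}$, $\lambda>0$ (for $\alpha=1$, $H_t=t$). Set $\bar V_t=t+H_{\gamma^+_t}$, $\bar V^{-1}_t=\inf\{s:\bar V_s>t\}$ and $\bar X_t=X^+_{\bar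 V^{-1}_t}$. The local times of $\bar X$ are the occupation times $$\bar\gamma_t(a)=\int_0^t\mathbf{1}_{\{a\}}(\bar X_s)\,ds,\quad \bar\gamma_t(b)=\int_0^t\mathbf{1}_{\{b\}}(\bar X_s)\,ds,\quad \bar\gamma_t=\bar\gamma_t(a)+\bar\gamma_t(b),$$ and $\bar r_t=\inf\{s\ge0:\bar\gamma_s>t\}$, so $\bar\gamma_{\bar r_t}=t$. Renewal structure. Set $T^*_0=T^*_0(\partial)=0$ and, for $j\ge1$, $$T^*_j:=\inf\{t>T^*_{j-1}(\partial): X^+_t=0\},\qquad T^*_j(\partial):=\inf\{t>T^*_j: X^+_t\in\{a,b\}\},$$ $$\theta^*_j=\begin{cases}+1,& X^+_{T^*_{j-1}(\partial)}=a,\\ -1,& X^+_{T^*_{j-1}(\partial)}=b.\end{cases}$$ Let $T_j=\gamma^+_{T^*_j}$ (so $T_0=0$), $T^L_j=H_{T_j}$, $e^L_j=T^L_j-T^L_{j-1}=H_{\gamma^+_{T^*_j}}-H_{\gamma^+_{T^*_{j-1}(\partial)}}$ for $j\ge1$, and $N^L_t=\max\{n\ge0:T^L_n\le t\}$. *)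

(* Defs.v *)
From HB Require Import structures.
From mathcomp Require Import all_boot all_order all_algebra.
From mathcomp Require Import all_classical all_reals all_analysis.

Set Implicit Arguments.
Unset Strict Implicit.
Unset Printing Implicit Defensive.

Import Order.TTheory GRing.Theory Num.Theory.
Import numFieldNormedType.Exports.

Local Open Scope classical_set_scope.
Local Open Scope ring_scope.

(* A process is a family X : R -> {RV P >-> R}; only times t >= 0 matter. Path
   properties are required, and the theorem is stated, almost surely. *)

Section processes.
Context d (T : measurableType d) (R : realType) (P : probability T R).

(* Each A i may be the whole line, so the product rule for the full family
   contains the product rule for every subfamily. *)
Definition mutually_independent n (Y : 'I_n -> T -> R) :=
  forall A : 'I_n -> set R, (forall i, measurable (A i)) ->
    P (\bigcap_(i in [set: 'I_n]) (Y i @^-1` A i)) =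
    (\prod_(i < n) P (Y i @^-1` A i))%E.

Definition process_sigma_algebra (D : set R) (X : R -> {RV P >-> R}) :
    set (set T) :=
  <<s [set E | exists t A, [/\ D t, measurable A & E = X t @^-1` A]] >>.

Definition independent_sigma_algebras (F G : set (set T)) :=
  forall A B, F A -> G B -> P (A `&` B) = (P A * P B)%E.

Definition times : set R := [set t | 0 <= t].

Definition independent_increments (X : R -> {RV P >-> R}) :=
  forall n (t : nat -> R), 0 <= t 0%N -> (forall i, t i <= t i.+1) ->
    mutually_independent (fun i : 'I_n => (X (t i.+1) \- X (t i))%R).

(* Equality of laws is tested on measurable sets only: the values of P on
   other sets carry no meaning. *)
Definition stationary_increments (X : R -> {RV P >-> R}) :=
  forall s t, 0 <= s -> s <= t -> forall A : set R, measurable A ->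
    P ((X t \- X s)%R @^-1` A) = P (X (t - s) @^-1` A).

Definition continuous_path (f : R -> R) :=
  {within `[0, +oo[, continuous f}.

Definition nondecreasing_path (f : R -> R) :=
  forall s t, 0 <= s -> s <= t -> f s <= f t.

Definition cadlag_path (f : R -> R) :=
  (forall t, 0 <= t -> f x @[x --> t^'+] --> f t) /\
  (forall t, 0 < t -> cvg (f x @[x --> t^'-])).

(* Brownian motion started at 0 with variance 2t, i.e. with generator the
   second derivative; the second parameter of normal_prob is the standard
   deviation. *)
Record brownian_motion (B : R -> {RV P >-> R}) : Prop := BrownianMotion {
  bm_start : {ae P, forall w, B 0 w = 0};
  bm_continuous : {ae P, forall w, continuous_path (fun t => B t w)};
  bm_independent : independent_increments B;
  bm_normal : forall s t, 0 <= s -> s < t -> forall A : set R, measurable A ->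
    P ((B t \- B s)%R @^-1` A) = normal_prob 0 (Num.sqrt (2 * (t - s))) A
}.

(* For alpha = 1 the Laplace transform forces H t = t almost surely. *)
Record stable_subordinator (alpha : R) (H : R -> {RV P >-> R}) : Prop :=
  StableSubordinator {
  sub_start : {ae P, forall w, H 0 w = 0};
  sub_cadlag : {ae P, forall w, cadlag_path (fun t => H t w)};
  sub_nondecreasing : {ae P, forall w, nondecreasing_path (fun t => H t w)};
  sub_independent : independent_increments H;
  sub_stationary : stationary_increments H;
  sub_laplace : forall t lambda, 0 <= t -> 0 < lambda ->
    ('E_P[(fun w => expR (- (lambda * H t w)))%R] =
     (expR (- (t * lambda `^ alpha)))%R%:E)%E
}.

(* g increases only when the continuous path x is at c. *)
Definition increases_only_at (x : R -> R) (c : R) (g : R -> R) :=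
  forall s t, 0 <= s -> s <= t ->
    (forall u, s <= u -> u <= t -> x u != c) -> g s = g t.

Record boundary_local_time (x : R -> R) (c : R) (g : R -> R) : Prop :=
  BoundaryLocalTime {
  lt_start : g 0 = 0;
  lt_continuous : continuous_path g;
  lt_nondecreasing : nondecreasing_path g;
  lt_support : increases_only_at x c g
}.

(* Reflected Brownian motion on [a, b], given through its Skorokhod
   decomposition with boundary local times ga at a and gb at b. *)
Record reflected_brownian_motion (a b : R) (X B ga gb : R -> {RV P >-> R}) :
    Prop := ReflectedBrownianMotion {
  rbm_driver : brownian_motion B;
  rbm_start_independent :
    independent_sigma_algebras (process_sigma_algebra [set 0] X)
                               (process_sigma_algebra times B);
  rbm_continuous : {ae P, forall w, continuous_path (fun t => X t w)};
  rbm_range : {ae P, forall w, forall t, 0 <= t -> a <= X t w <= b};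
  rbm_local_time_a : {ae P, forall w,
    boundary_local_time (fun t => X t w) a (fun t => ga t w)};
  rbm_local_time_b : {ae P, forall w,
    boundary_local_time (fun t => X t w) b (fun t => gb t w)};
  rbm_skorokhod : {ae P, forall w, forall t, 0 <= t ->
    X t w = X 0 w + B t w + ga t w - gb t w}
}.

Definition independent_processes (X Y : R -> {RV P >-> R}) :=
  independent_sigma_algebras (process_sigma_algebra times X)
                             (process_sigma_algebra times Y).

End processes.

(* Pathwise functionals of a path x of the reflected motion, the path g of its
   total boundary local time and the path h of the subordinator. The real inf
   of an empty set is 0; the infima below are almost surely over nonempty
   sets. *)
Section paths.
Context (R : realType) (a b : R) (x g h : R -> R).

Definition Vbar (t : R) : R := t + h (g t).

Definition Vbar_inv (t : R) : R := inf [set s | 0 <= s /\ t < Vbar s].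

Definition Xbar (t : R) : R := x (Vbar_inv t).

Definition gammabar_at (c t : R) : R :=
  \int[lebesgue_measure]_(s in `[0, t]) (\1_[set c] (Xbar s)).

Definition gammabar (t : R) : R := gammabar_at a t + gammabar_at b t.

Definition rbar (t : R) : R := inf [set s | 0 <= s /\ t < gammabar s].

Definition midpoint_hit (s : R) : R := inf [set t | s < t /\ x t = 0].

Definition boundary_hit (s : R) : R :=
  inf [set t | s < t /\ (x t = a \/ x t = b)].

Fixpoint Tstar_bd (j : nat) : R :=
  if j is k.+1 then boundary_hit (midpoint_hit (Tstar_bd k)) else 0.

Definition Tstar (j : nat) : R :=
  if j is k.+1 then midpoint_hit (Tstar_bd k) else 0.

(* Used for j >= 1 only. *)
Definition theta (j : nat) : R :=
  if x (Tstar_bd j.-1) == a then 1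
  else if x (Tstar_bd j.-1) == b then -1 else 0.

Definition TL (j : nat) : R := h (g (Tstar j)).

(* Used for j >= 1 only. As g is constant on [Tstar j.-1, Tstar_bd j.-1], this
   is also h (g (Tstar j)) - h (g (Tstar_bd j.-1)). *)
Definition eL (j : nat) : R := TL j - TL j.-1.

(* The largest n with TL n <= t, which almost surely exists for all t >= 0
   (0 if there is no largest one). *)
Definition NL (t : R) : nat :=
  xget 0%N [set n | TL n <= t /\ forall m, TL m <= t -> (m <= n)%N].

End paths.

(* Main.v *)
(* Write k = h o g for the subordinator evaluated at the boundary local time and
   V t = t + k t for the sticky clock. Off the boundary g is locally constant,
   so the inverse of V is locally a translation there; since x spends no
   Lebesgue time on the boundary, Xbar spends exactly time u off the boundary
   before time V u, whence gammabar (V u) = k u. Between Tstar n and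
   Tstar n.+1 the path meets only the boundary point encoded by theta n.+1, so
   on that stretch gammabar_a - gammabar_b grows like theta n.+1 times gammabar;
   summing over the stretches gives the identity.

   The almost sure inputs are: B is unbounded in both directions, which makes
   every hitting time finite and g tend to infinity; H is unbounded, by its
   Laplace transform; and x spends no Lebesgue time on the boundary. For the
   last one, if x t = a then B t <= B s for all s shortly before t, which has
   probability zero for each fixed t, and Fubini's theorem applies. *)

Require Import Defs.
From HB Require Import structures.
From mathcomp Require Import all_boot all_order all_algebra.
From mathcomp Require Import all_classical all_reals all_analysis.
From mathcomp Require Import measurable_realfun ring lra.

Set Implicit Arguments.
Unset Strict Implicit.
Unset Printing Implicit Defensive.

Import Order.TTheory GRing.Theory Num.Theory.
Import numFieldNormedType.Exports.

Local Open Scope classical_set_scope.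
Local Open Scope ring_scope.

(** * The sticky clock *)

Section sticky_clock.
Context (R : realType) (g h : R -> R).
Hypothesis hg_nd : forall s t : R, 0 <= s -> s <= t -> h (g s) <= h (g t).
Hypothesis hg0 : h (g 0) = 0.

Local Notation V := (Vbar g h).
Local Notation inv := (Vbar_inv g h).

Lemma Vbar0 : V 0 = 0.
Proof. by rewrite /Vbar hg0 addr0. Qed.

Lemma Vbar_incr s t : 0 <= s -> s <= t -> t - s <= V t - V s.
Proof. by move=> s0 st; have := hg_nd s0 st; rewrite /Vbar; lra. Qed.

Lemma Vbar_ge t : 0 <= t -> t <= V t.
Proof. by move=> t0; have := Vbar_incr (lexx 0) t0; rewrite Vbar0; lra. Qed.

Let Vset t := [set s : R | 0 <= s /\ t < V s].

Let Vset_lb t : lbound (Vset t) 0.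
Proof. by move=> s []. Qed.

Let Vset_neq0 t : Vset t !=set0.
Proof.
exists (`|t| + 1); have n0 := normr_ge0 t; have tn := ler_norm t.
have b0 : 0 <= `|t| + 1 by lra.
by split => //; have := Vbar_ge b0; lra.
Qed.

Lemma Vbar_inv_ge0 t : 0 <= inv t.
Proof. exact: (lb_le_inf (@Vset_neq0 t) (@Vset_lb t)). Qed.

Lemma Vbar_inv_gt s t : inv t < s -> t < V s.
Proof.
move=> its; have [u [u0 tu] us] := inf_lt (Vset_neq0 t) its.
by apply: (lt_le_trans tu); have := Vbar_incr u0 (ltW us); lra.
Qed.

Lemma Vbar_inv_lt s t : 0 <= s -> s < inv t -> V s <= t.
Proof.
move=> s0; apply: contraTT; rewrite -ltNge -leNgt => tV.
by apply: ge_inf; [by exists 0; exact: Vset_lb|split].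
Qed.

Lemma Vbar_inv_nd s t : s <= t -> inv s <= inv t.
Proof.
move=> st; rewrite leNgt; apply/negP => ts.
have [m1 m2] := midf_lt ts; set m := _ / _ in m1 m2.
have m0 : 0 <= m by rewrite (le_trans (Vbar_inv_ge0 t))// ltW.
have := Vbar_inv_lt m0 m2; have := Vbar_inv_gt m1; lra.
Qed.

(** Only the strict growth of [V] enters, so the identity also holds where [h] makes the clock
    jump. *)
Lemma Vbar_invK u : 0 <= u -> inv (V u) = u.
Proof.
move=> u0; apply/eqP; rewrite eq_le; apply/andP; split.
  apply/ler_addgt0Pr => e e0; apply: ge_inf; first by exists 0; exact: Vset_lb.
  have ue : u <= u + e by lra.
  by split; [lra|have := Vbar_incr u0 ue; lra].
rewrite leNgt; apply/negP => iu; have := Vbar_inv_gt iu.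
by rewrite ltxx.
Qed.

Lemma measurable_Vbar_inv : measurable_fun setT inv.
Proof.
apply: nondecreasing_measurable => // s t; exact: Vbar_inv_nd.
Qed.

(** Constancy is asked of the composite [h (g _)], which is all that the clock sees. *)
Definition flat_on (p q : R) := forall u, p <= u -> u <= q -> h (g u) = h (g p).

(** On [[p, q]] the clock is the translation by [h (g p)], so its inverse translates back. Strict
    bounds leave out the levels that [V] may jump over at the endpoints. *)
Lemma Vbar_inv_flat p q s : 0 <= p -> flat_on p q ->
  (p < inv s < q) = (p + h (g p) < s < q + h (g p)).
Proof.
move=> p0 fl; apply/idP/idP => /andP[].
  move=> pi iq.
  (* [V] compares with [s] only strictly to the right or left of [inv s], so it is evaluated at
     midpoints. *)
  have [m1 m2] := midf_lt iq; set m := _ / _ in m1 m2.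
  have [k1 k2] := midf_lt pi; set k := _ / _ in k1 k2.
  have := Vbar_inv_gt m1; rewrite /Vbar fl ?(ltW m2)//; last lra.
  have k0 : 0 <= k by lra.
  have := Vbar_inv_lt k0 k2; rewrite /Vbar fl ?(ltW k1)//; last lra.
  lra.
move=> ps sq; suff -> : inv s = s - h (g p) by lra.
have /Vbar_invK <- : 0 <= s - h (g p) by lra.
by congr inv; rewrite /Vbar fl; lra.
Qed.

Lemma Vbar_inv_flatE p q s : 0 <= p -> flat_on p q ->
  p < inv s < q -> inv s = s - h (g p).
Proof.
move=> p0 fl; rewrite (Vbar_inv_flat s p0 fl) => /andP[ps sq].
have /Vbar_invK <- : 0 <= s - h (g p) by lra.
by congr inv; rewrite /Vbar fl; lra.
Qed.

Lemma Vbar_inv_flatK p q s : 0 <= p -> flat_on p q ->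
  p < inv s < q -> V (inv s) = s.
Proof.
move=> p0 fl pq; have E := Vbar_inv_flatE p0 fl pq.
rewrite /Vbar (fl (inv s)) ?E; lra.
Qed.

End sticky_clock.

(** * Translation invariance of Lebesgue measure *)

Section translation.
Context (R : realType).
Local Notation mu := (@lebesgue_measure R).

(** The pushforward under the shift agrees with Lebesgue measure on half-open intervals, hence
    everywhere by uniqueness. *)
Lemma lebesgue_measure_subr (c : R) (A : set R) : measurable A ->
  mu [set s | A (s - c)] = mu A.
Proof.
move=> mA; have mf : measurable_fun setT (fun s : measurableTypeR R => s - c : measurableTypeR R).
  exact: measurable_funB.
apply/esym; rewrite -[RHS]/(pushforward mu
  (fun s : measurableTypeR R => s - c : measurableTypeR R) A).
apply: lebesgue_measure_unique => //= _ [[a b]] _ <-.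
rewrite /pushforward/= (_ : _ @^-1` _ = `]a + c, b + c]%classic).
  by rewrite !lebesgue_measure_itv/= !lte_fin ltrD2r -!EFinB; case: ifP => // _; congr EFin; lra.
apply/seteqP; split => s /=; rewrite !in_itv/=; lra.
Qed.
End translation.

(** * Lebesgue measure under the inverse clock *)

Section occupation.
Context (R : realType) (g h : R -> R).
Hypothesis hg_nd : forall s t : R, 0 <= s -> s <= t -> h (g s) <= h (g t).
Hypothesis hg0 : h (g 0) = 0.

Local Notation V := (Vbar g h).
Local Notation inv := (Vbar_inv g h).
Local Notation mu := (@lebesgue_measure R).

(** Enumerates the flat intervals with rational endpoints; every other code yields [(0, 0)], whose
    open interval is empty. *)
Let E (n : nat) : R * R :=
  let: (p, q) := odflt (0, 0) (unpickle n : option (rat * rat)) in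
  if `[< 0 <= ratr p :> R /\ flat_on g h (ratr p) (ratr q) >]
  then (ratr p, ratr q) else (0, 0).

Let E_flat n : 0 <= (E n).1 /\ flat_on g h (E n).1 (E n).2.
Proof.
rewrite /E; case: (odflt _ _) => p q; case: asboolP => [//|_]; split => //=.
by move=> u u0 u0'; congr (h (g _)); lra.
Qed.

Let F n : set R := `](E n).1, (E n).2[%classic.

(* On an interval where the local time is constant, the inverse clock is a
   translation. *)
Lemma occupation_flat (A : set R) : measurable A ->
  (forall u, A u -> exists p q : R, [/\ 0 <= p, flat_on g h p q & p < u < q]) ->
  mu [set s | A (inv s)] = mu A.
Proof.
move=> mA Aflat.
(* The rational flat intervals cover [A]; [seqDU] makes them disjoint, so that measures can be
   summed piece by piece. *)
have AF : A = \bigcup_n (A `&` seqDU F n).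
  rewrite -setI_bigcupr -seqDU_bigcup_eq; apply/esym/setIidl => u /Aflat.
  move=> [p [q [p0 fl /andP[pu uq]]]].
  have [p'] := rat_in_itvoo pu; rewrite in_itv/= => /andP[pp' p'u].
  have [q'] := rat_in_itvoo uq; rewrite in_itv/= => /andP[uq' q'q].
  have fl' : 0 <= ratr p' :> R /\ flat_on g h (ratr p') (ratr q').
    split=> [|v pv vq]; first lra.
    by rewrite (fl v) ?(fl (ratr p'))//; lra.
  exists (pickle (p', q')) => //; rewrite /F /E pickleK/= asboolT//=.
  by rewrite in_itv/= p'u uq'.
have mFD n : measurable (seqDU F n).
  apply: measurableD; first exact: measurable_itv.
  by apply: bigsetU_measurable => i _; exact: measurable_itv.
have mAF n : measurable (A `&` seqDU F n) := measurableI _ _ mA (mFD n).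
have minv := measurable_Vbar_inv hg_nd hg0.
have tF : trivIset setT (fun n => A `&` seqDU F n).
  exact/trivIset_setIl/trivIset_seqDU.
rewrite [RHS](_ : _ = mu (\bigcup_n (A `&` seqDU F n))); last by rewrite -AF.
rewrite (_ : [set s | A (inv s)] = \bigcup_n (inv @^-1` (A `&` seqDU F n))); last first.
  by rewrite -preimage_bigcup -AF.
rewrite measure_bigcup; first last.
- by move=> i j _ _ [s [Fi Fj]]; apply: (tF i j) => //; exists (inv s).
- by move=> n _; rewrite -[_ @^-1` _]setTI; apply: minv => //; exact: mAF.
rewrite measure_bigcup; first last.
- exact: tF.
- by move=> n _; exact: mAF.
apply: eq_eseriesr => n _.
have [p0 fl] := E_flat n.
(* On each piece the preimage under [inv] is the piece shifted by the constant [h (g p)]. *)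
apply: etrans (lebesgue_measure_subr (h (g (E n).1)) (mAF n)).
congr (mu _); apply/seteqP; split => s /= [As Fs]; have [Fsn _] := Fs.
  move: (Fsn); rewrite /F/= in_itv/= => /(Vbar_inv_flatE hg_nd hg0 p0 fl) <-.
  by split.
move: (Fsn); rewrite /F/= in_itv/= => pq.
have {}pq : (E n).1 < inv s < (E n).2 by rewrite (Vbar_inv_flat hg_nd hg0 s p0 fl); lra.
by rewrite (Vbar_inv_flatE hg_nd hg0 p0 fl pq); split.
Qed.


End occupation.

Lemma continuous_path_dist (R : realType) (f : R -> R) (t e : R) :
  continuous_path f -> 0 <= t -> 0 < e ->
  exists2 d, 0 < d & forall s, 0 <= s -> `|s - t| < d -> `|f s - f t| < e.
Proof.
move=> /subspace_continuousP fc t0 e0.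
have /= := fc t; rewrite in_itv/= andbT => /(_ t0).
move=> /cvgrPdist_lt/(_ _ e0)[d d0 H]; exists d => // s s0 std.
rewrite distrC; apply: H => /=; first by rewrite distrC.
by rewrite in_itv/= andbT.
Qed.

Lemma continuous_path_measurable (R : realType) (f : R -> R) :
  continuous_path f -> measurable_fun (`[0, +oo[%classic : set R) f.
Proof. by move=> fc; exact: subspace_continuous_measurable_fun. Qed.

Lemma lebesgue_measure_itvcc (R : realType) (s t : R) : s <= t ->
  lebesgue_measure (`[s, t]%classic : set R) = (t - s)%:E.
Proof.
rewrite le_eqVlt => /predU1P[->|st]; last first.
  by rewrite lebesgue_measure_itv/= lte_fin st EFinB.
by rewrite lebesgue_measure_itv/= lte_fin ltxx subrr.
Qed.

(** * Occupation times of the sticky path *)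

Section gammabar_at.
Context (R : realType) (x g h : R -> R).
Hypothesis xc : continuous_path x.
Hypothesis hg_nd : forall s t : R, 0 <= s -> s <= t -> h (g s) <= h (g t).
Hypothesis hg0 : h (g 0) = 0.

Local Notation inv := (Vbar_inv g h).
Local Notation mu := (@lebesgue_measure R).
Local Notation Z c := [set s | Xbar x g h s = c].

Lemma measurable_Xbar_eq c : measurable (Z c).
Proof.
have mx := continuous_path_measurable xc.
have minv := measurable_Vbar_inv hg_nd hg0.
(* [x] is known to be measurable only on nonnegative times; [inv] takes its values there. *)
rewrite (_ : Z c = setT `&` inv @^-1` (`[0, +oo[ `&` x @^-1` [set c])).
  apply: minv => //; apply: mx => //; exact: measurable_set1.
rewrite setTI; apply/seteqP; split => s /=; last by case.
by rewrite in_itv/= andbT Vbar_inv_ge0.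
Qed.

Lemma gammabar_atE c t : gammabar_at x g h c t = fine (mu (Z c `&` `[0, t])).
Proof.
rewrite /gammabar_at /Rintegral.
under eq_integral do rewrite -[\1_ _ _]/(\1_(Z c) _).
by rewrite integral_indic//; exact: measurable_Xbar_eq.
Qed.

Lemma mu_itv_le (A : set R) i (s t : R) : measurable A -> s <= t ->
  (mu (A `&` [set` Interval (BSide i s) (BRight t)]) <= (t - s)%:E)%E.
Proof.
move=> mA st.
have mI : measurable [set` Interval (BSide i s) (BRight t)] by exact: measurable_itv.
apply: le_trans (_ : _ <= mu [set` Interval (BSide i s) (BRight t)])%E _.
  by apply: le_measure; rewrite ?inE//; exact: measurableI.
rewrite lebesgue_measure_itv/=; case: ifPn => //; rewrite ?lee_fin; lra.
Qed.

Lemma fin_mu_itv (A : set R) i (s t : R) : measurable A -> s <= t ->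
  mu (A `&` [set` Interval (BSide i s) (BRight t)]) \is a fin_num.
Proof.
move=> mA st; rewrite ge0_fin_numE//.
by apply: (le_lt_trans (mu_itv_le i mA st)); exact: ltry.
Qed.

Lemma fine_mu_itvD (A : set R) (s t : R) : measurable A -> 0 <= s -> s <= t ->
  fine (mu (A `&` `[0, t])) =
  fine (mu (A `&` `[0, s])) + fine (mu (A `&` `]s, t])).
Proof.
move=> mA s0 st.
have mI i (u v : R) : measurable (A `&` [set` Interval (BSide i u) (BRight v)]).
  by apply: measurableI => //; exact: measurable_itv.
rewrite -fineD ?fin_mu_itv// -measureU//.
- congr (fine (mu _)); rewrite -setIUr; congr (_ `&` _).
  apply/seteqP; split => u /=; rewrite !in_itv/=; last lra.
  by case: (leP u s) => us; [left; lra|right; lra].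
- exact: mI.
- exact: mI.
- by rewrite -subset0 => u /= [[_ +] [_]]; rewrite !in_itv/=; lra.
Qed.

Lemma gammabar_at_lip c s t : 0 <= s -> s <= t ->
  0 <= gammabar_at x g h c t - gammabar_at x g h c s <= t - s.
Proof.
move=> s0 st; have mZ := measurable_Xbar_eq c.
rewrite !gammabar_atE (fine_mu_itvD mZ s0 st) addrC addKr.
rewrite fine_ge0//= -lee_fin fineK ?fin_mu_itv//.
exact: mu_itv_le.
Qed.

Lemma gammabar_at_const c s t : 0 <= s -> s <= t ->
  (forall u, s < u -> u <= t -> Xbar x g h u <> c) ->
  gammabar_at x g h c t = gammabar_at x g h c s.
Proof.
move=> s0 st H; have mZ := measurable_Xbar_eq c.
rewrite !gammabar_atE (fine_mu_itvD mZ s0 st).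
rewrite (_ : _ `&` `]s, t] = set0) ?measure0/= ?addr0//.
rewrite -subset0 => u /= [uc]; rewrite in_itv/= => /andP[su ut].
exact: (H u).
Qed.

Lemma gammabar_at0 c : gammabar_at x g h c 0 = 0.
Proof.
rewrite gammabar_atE; suff -> : mu (Z c `&` `[0, 0]) = 0%E by [].
apply/eqP; rewrite -measure_le0 -[X in (_ <= X)%E](_ : (0 - 0)%:E = 0%E); last by rewrite subrr.
by apply: mu_itv_le => //; exact: measurable_Xbar_eq.
Qed.

(** Up to time [V u] the sticky path spends exactly time [u] off the boundary, because [inv]
    preserves the measure of off-boundary times and boundary times are null. What remains of [V u]
    is [h (g u)]. *)
Lemma gammabar_Vbar (a b u : R) : a != b ->
  (forall t : R, 0 <= t -> x t <> a -> x t <> b ->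
     exists p q : R, [/\ 0 <= p, flat_on g h p q & p < t < q]) ->
  (forall c, c = a \/ c = b -> mu.-negligible [set t | 0 <= t /\ x t = c]) ->
  0 <= u ->
  gammabar a b x g h (Vbar g h u) = h (g u).
Proof.
move=> ab Hfl H0 u0.
have mx := continuous_path_measurable xc.
have mZa := measurable_Xbar_eq a; have mZb := measurable_Xbar_eq b.
have mC c : measurable [set t | 0 <= t /\ x t = c].
  rewrite (_ : [set _ | _] = `[0, +oo[ `&` x @^-1` [set c]).
    by apply: mx => //; exact: measurable_set1.
  by apply/seteqP; split => t/=; rewrite in_itv/= andbT.
pose N := [set t | 0 <= t /\ x t = a] `|` [set t | 0 <= t /\ x t = b].
have mN : measurable N by exact: measurableU.
have N0 : mu N = 0%E.
  apply: measure_negligible => //.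
  by apply: negligibleU; apply: H0; [left|right].
pose I := `[0, u] `\` N.
have mI : measurable I by exact: measurableD.
have muI : mu I = u%:E.
  rewrite measureD//; last by rewrite [X in (X < _)%E]lebesgue_measure_itvcc// ltry.
  rewrite [X in (X - _)%E]lebesgue_measure_itvcc// subr0.
  rewrite [X in (_ - X)%E](_ : _ = 0%E) ?sube0//.
  apply: measure_negligible; first exact: measurableI.
  by apply: (negligibleS (@subIsetr _ _ _)); exact/negligibleP.
have Ifl t : I t -> exists p q : R, [/\ 0 <= p, flat_on g h p q & p < t < q].
  rewrite /I/= in_itv/= => -[/andP[t0 _] nN].
  by apply: Hfl => // xt; apply: nN; [left|right].
have occ := occupation_flat hg_nd hg0 mI Ifl.
set J := [set s | I (inv s)] in occ.
have V0 := Vbar_ge hg_nd hg0 u0; set v := Vbar g h u in V0 *.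
have mJ : measurable J.
  rewrite -[J]setTI; apply: measurable_Vbar_inv => //.
(* [J] consists of the sticky times up to [V u] spent off the boundary: [V (inv s) = s] gives one
   inclusion, [inv (V u) = u] the other. *)
have JE : J = ~` (Z a `|` Z b) `&` `[0, v].
  apply/seteqP; split => s /=.
    move=> Is; have [p [q [p0 fl pq]]] := Ifl _ Is.
    have sE := Vbar_inv_flatK hg_nd hg0 p0 fl pq.
    move: Is => -[/itvP iE nN]; have i0 : 0 <= inv s by rewrite iE.
    have iu : inv s <= u by rewrite iE.
    split.
      by move=> [xs|xs]; apply: nN; [left|right]; split.
    rewrite /= in_itv/= -sE /v; have := Vbar_ge hg_nd hg0 i0.
    have := Vbar_incr hg_nd i0 iu; lra.
  move=> [nZ /itvP sE]; have sv : s <= v by rewrite sE.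
  split.
    rewrite /= in_itv/= (Vbar_inv_ge0 hg_nd hg0)/= -(Vbar_invK hg_nd hg0 u0).
    exact: Vbar_inv_nd.
  by case=> -[_ xs]; apply: nZ; [left|right].
have mv : fine (mu ((Z a `|` Z b) `&` `[0, v])) = h (g u).
  have mZ := measurableU _ _ mZa mZb.
  have mIv : measurable (`[0, v]%classic : set R) by exact: measurable_itv.
  (* [[0, v]] splits into the off-boundary times, of measure [u], and the boundary times. *)
  have : v%:E = (u%:E + mu ((Z a `|` Z b) `&` `[0%R, v]))%E.
    have -> : v%:E = mu `[0, v]%classic.
      by rewrite lebesgue_measure_itvcc ?subr0// (le_trans u0 V0).
    by rewrite -muI -occ JE setIC -setDE (setIC (_ `|` _)); exact: measureDI.
  rewrite -[X in (_ + X)%E]fineK; last by apply: fin_mu_itv => //; lra.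
  by rewrite -EFinD => -[]; rewrite /v /Vbar; lra.
rewrite /gammabar !gammabar_atE -mv setIUl measureU; first last.
- rewrite -subset0 => s /= [[sa _] [sb _]].
  by move: ab; rewrite -sa -sb eqxx.
- exact: measurableI.
- exact: measurableI.
by rewrite fineD// fin_mu_itv//; lra.
Qed.

End gammabar_at.

(** * The pathwise identity *)

(** Continuity and closedness of [D] make the infimum attained; starting outside [D] makes it
    strictly later than [s]. *)
Lemma first_hit (R : realType) (x : R -> R) (D : set R) (s : R) :
  continuous_path x -> closed D -> 0 <= s -> ~ D (x s) ->
  (exists2 t : R, s < t & D (x t)) ->
  let tau := inf [set t | s < t /\ D (x t)] in
  [/\ s < tau, D (x tau) & forall u, s <= u -> u < tau -> ~ D (x u)].
Proof.
move=> xc Dc s0 nDs [t0 st0 Dt0] tau.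
set S := [set t | s < t /\ D (x t)].
have S0 : S !=set0 by exists t0.
have Sb : lbound S s by move=> u [/ltW].
have stau : s <= tau by exact: lb_le_inf.
have Dtau : D (x tau).
  apply: contrapT => nD.
  have : nbhs (x tau) (~` D) by apply: open_nbhs_nbhs; split => //; exact: closed_openC.
  move=> /nbhs_ballP[e /= e0 eD].
  have [d d0 Hd] := continuous_path_dist xc (le_trans s0 stau) e0.
  have [t [st Dt] td] : exists2 t : R, S t & t < tau + d.
    by apply: inf_lt => //; rewrite ltrDl.
  have taut : tau <= t by apply: ge_inf; [exists s|split].
  apply: (eD (x t)) => //; rewrite /ball/= distrC; apply: Hd; first lra.
  by rewrite ger0_norm; lra.
split=> //.
  by rewrite lt_neqAle stau andbT; apply/eqP => E; apply: nDs; rewrite E.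
move=> u; rewrite le_eqVlt => /predU1P[<-//|su] utau Du.
have : tau <= u by apply: ge_inf; [exists s|split].
lra.
Qed.

Lemma continuous_path_sign (R : realType) (x : R -> R) (s t : R) :
  continuous_path x -> 0 <= s -> s <= t ->
  (forall u, s <= u -> u <= t -> x u <> 0) -> (0 < x s) = (0 < x t).
Proof.
move=> xc s0 st x0.
have xc' : {within `[s, t], continuous x}.
  apply: continuous_subspaceW xc => u /=; rewrite !in_itv/= andbT.
  by move=> /andP[+ _]; exact: le_trans.
have nz : ~ (Num.min (x s) (x t) <= 0 <= Num.max (x s) (x t)).
  move=> /(IVT st xc')[u]; rewrite in_itv/= => /andP[su ut]; exact: x0.
have xs := x0 _ (lexx s) st; have xt := x0 _ st (lexx t).
move: nz; rewrite ge_min le_max.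
case: (ltgtP (x s) 0) => [xs0|xs0|//]; case: (ltgtP (x t) 0) => [xt0|xt0|//] //.
Qed.

Lemma closed_singleton (R : realType) (c : R) : closed [set c].
Proof. exact: (accessible_closed_set1 (hausdorff_accessible (@Rhausdorff R))). Qed.

Section pathwise.
Context (R : realType) (a b : R) (x B ga gb h : R -> R).
Implicit Types s t u v M c : R.
Hypothesis a_lt0 : a < 0.
Hypothesis b_gt0 : 0 < b.
Hypothesis xc : continuous_path x.
Hypothesis x_range : forall t, 0 <= t -> a <= x t <= b.
Hypothesis x_start : x 0 = a \/ x 0 = b.
Hypothesis lta : boundary_local_time x a ga.
Hypothesis ltb : boundary_local_time x b gb.
Hypothesis skorokhod : forall t, 0 <= t -> x t = x 0 + B t + ga t - gb t.
Hypothesis B_up : forall M, exists2 t : R, 0 <= t & M < B t.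
Hypothesis B_down : forall M, exists2 t : R, 0 <= t & B t < M.
Hypothesis h_start : h 0 = 0.
Hypothesis h_nd : nondecreasing_path h.
Hypothesis h_up : forall M, exists2 t : R, 0 <= t & M < h t.
Hypothesis boundary_null : forall c, c = a \/ c = b ->
  (@lebesgue_measure R).-negligible [set t | 0 <= t /\ x t = c].

Local Notation g := (fun t => ga t + gb t).

(** * Local times and hitting times along one path *)

Let ga_nd s t : 0 <= s -> s <= t -> ga s <= ga t.
Proof. exact: lt_nondecreasing lta s t. Qed.

Let gb_nd s t : 0 <= s -> s <= t -> gb s <= gb t.
Proof. exact: lt_nondecreasing ltb s t. Qed.

Let ga_ge0 t : 0 <= t -> 0 <= ga t.
Proof. by move=> t0; rewrite -(lt_start lta); exact: ga_nd. Qed.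

Let gb_ge0 t : 0 <= t -> 0 <= gb t.
Proof. by move=> t0; rewrite -(lt_start ltb); exact: gb_nd. Qed.

Let ga_const s t : 0 <= s -> s <= t ->
  (forall u, s <= u -> u <= t -> x u <> a) -> ga s = ga t.
Proof. by move=> s0 st H; apply: (lt_support lta) => // u su ut; apply/eqP/H. Qed.

Let gb_const s t : 0 <= s -> s <= t ->
  (forall u, s <= u -> u <= t -> x u <> b) -> gb s = gb t.
Proof. by move=> s0 st H; apply: (lt_support ltb) => // u su ut; apply/eqP/H. Qed.

Let hg_nd s t : 0 <= s -> s <= t -> h (g s) <= h (g t).
Proof.
move=> s0 st; have t0 := le_trans s0 st; apply: h_nd => /=.
  by rewrite addr_ge0// ?ga_ge0// gb_ge0.
by rewrite lerD// ?ga_nd// gb_nd.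
Qed.

Let hg0 : h (g 0) = 0.
Proof. by rewrite /= (lt_start lta) (lt_start ltb) addr0 h_start. Qed.

(** The path stays in [[a, b]], so a very low value of [B] has to be compensated by a large [ga]. *)
Let hg_up M : exists2 t : R, 0 <= t & M < h (g t).
Proof.
have a0 := a_lt0; have b0 := b_gt0.
have [u u0 Mu] := h_up M; have [t t0 Bt] := B_down (a - b - u).
exists t => //; apply: (lt_le_trans Mu); apply: h_nd => //=.
have := skorokhod t0; have := x_range t0; have := x_range (lexx 0).
have := gb_ge0 t0; lra.
Qed.

(** If 0 were avoided from [s + 1] on, the path would keep its sign and the local time at the
    opposite end would be frozen. An extreme value of [B] would then push the path out of
    [[a, b]]. *)
Lemma hits_midpoint s : 0 <= s -> exists2 t : R, s < t & x t = 0.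
Proof.
have a0 := a_lt0; have b0 := b_gt0.
move=> s0; apply: contrapT => H.
have nz (t : R) : s + 1 <= t -> x t <> 0.
  by move=> st xt; apply: H; exists t => //; lra.
have s1 : 0 <= s + 1 by lra.
have sgn (t : R) : s + 1 <= t -> (0 < x (s + 1)) = (0 < x t).
  by move=> st; apply: continuous_path_sign => // u su _; exact: nz.
have xr0 := x_range (lexx 0).
have [xp|xn] := ltP 0 (x (s + 1)).
  have [t t0 Bt] := B_down (a - b - ga (s + 1)).
  have xt := x_range t0; have := skorokhod t0; have := gb_ge0 t0.
  (* In both cases [ga t] is at most [ga (s + 1)]: by monotonicity before [s + 1], by constancy
     after it. *)
  have [ts|/ltW st] := leP t (s + 1); first by have := ga_nd t0 ts; lra.
  suff : ga (s + 1) = ga t by lra.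
  apply: ga_const => // u su _ xu.
  have xu0 : 0 < x u by rewrite -(sgn _ su).
  lra.
have [t t0 Bt] := B_up (b - a + gb (s + 1)).
have xt := x_range t0; have := skorokhod t0; have := ga_ge0 t0.
have [ts|/ltW st] := leP t (s + 1); first by have := gb_nd t0 ts; lra.
suff : gb (s + 1) = gb t by lra.
apply: gb_const => // u su _ xu.
have xu0 : 0 < x (s + 1) by rewrite (sgn _ su) xu.
lra.
Qed.

(** If the boundary were avoided from [s + 1] on, [gb] would be frozen and a high value of [B] would
    push the path above [b]. *)
Lemma hits_boundary s : 0 <= s -> exists2 t : R, s < t & (x t = a \/ x t = b).
Proof.
have a0 := a_lt0; have b0 := b_gt0.
move=> s0; apply: contrapT => H.
have nz (t : R) : s + 1 <= t -> ~ (x t = a \/ x t = b).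
  by move=> st xt; apply: H; exists t => //; lra.
have s1 : 0 <= s + 1 by lra.
have xr0 := x_range (lexx 0).
have [t t0 Bt] := B_up (b - a + gb (s + 1)).
have xt := x_range t0; have := skorokhod t0; have := ga_ge0 t0.
have [ts|/ltW st] := leP t (s + 1); first by have := gb_nd t0 ts; lra.
suff : gb (s + 1) = gb t by lra.
by apply: gb_const => // u su _ xu; apply: (nz u) => //; right.
Qed.

Lemma flat_off_boundary t : 0 <= t -> x t <> a -> x t <> b ->
  exists p q : R, [/\ 0 <= p, flat_on g h p q & p < t < q].
Proof.
have a0 := a_lt0; have b0 := b_gt0.
move=> t0 xa xb.
(* The path starts on the boundary, so [t] is positive and an interval around it fits into the
   nonnegative times. *)
have t_gt0 : 0 < t.
  rewrite lt_neqAle t0 andbT; apply/eqP => t00.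
  by move: xa xb; rewrite -t00; case: x_start.
have e0 : 0 < Num.min `|x t - a| `|x t - b|.
  by rewrite lt_min !normr_gt0 !subr_eq0; apply/andP; split; apply/eqP.
have [d d0 Hd] := continuous_path_dist xc t0 e0.
have off u : 0 <= u -> `|u - t| < d -> x u <> a /\ x u <> b.
  move=> u0 /(Hd _ u0); rewrite lt_min => /andP[xa' xb'].
  by split=> xu; [move: xa'|move: xb']; rewrite xu distrC ltxx.
have m0 : 0 < Num.min d t by rewrite lt_min d0.
have md : Num.min d t <= d by rewrite ge_min lexx.
have mt : Num.min d t <= t by rewrite ge_min lexx orbT.
set m := Num.min d t in m0 md mt.
exists (t - m / 2), (t + m / 2); split; [lra| |lra].
move=> u pu uq; have p0 : 0 <= t - m / 2 by lra.
congr (h (_ + _)); apply/esym; [apply: ga_const|apply: gb_const] => // v pv vu;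
  have [] // := @off v _ _; first [lra | by rewrite ltr_norml; lra].
Qed.

(** * The renewal times *)

Local Notation Tbd := (Tstar_bd a b x).
Local Notation T := (Tstar a b x).

Let boundary_closed : closed [set y : R | y = a \/ y = b].
Proof.
have -> : [set y : R | y = a \/ y = b] = [set a] `|` [set b] by [].
by apply: closedU; exact: closed_singleton.
Qed.

Let midpoint_hitP s : 0 <= s -> (x s = a \/ x s = b) ->
  [/\ s < midpoint_hit x s, x (midpoint_hit x s) = 0 &
      forall u, s <= u -> u < midpoint_hit x s -> x u <> 0].
Proof.
have a0 := a_lt0; have b0 := b_gt0.
move=> s0 xs; apply: (@first_hit _ _ [set 0]) => //.
- by move=> /= x0; case: xs; lra.
- exact: hits_midpoint.
Qed.

Let boundary_hitP s : 0 <= s -> x s = 0 ->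
  let tau := boundary_hit a b x s in
  [/\ s < tau, x tau = a \/ x tau = b &
      forall u, s <= u -> u < tau -> ~ (x u = a \/ x u = b)].
Proof.
have a0 := a_lt0; have b0 := b_gt0.
move=> s0 xs; apply: (@first_hit _ _ [set y : R | y = a \/ y = b]) => //.
- by move=> /= []; lra.
- exact: hits_boundary.
Qed.

Let TbdP n : 0 <= Tbd n /\ (x (Tbd n) = a \/ x (Tbd n) = b).
Proof.
have a0 := a_lt0; have b0 := b_gt0.
elim: n => [//|n [T0 Tx]] /=.
have [Tm xm _] := midpoint_hitP T0 Tx.
have [mb xb _] := boundary_hitP (le_trans T0 (ltW Tm)) xm.
by split => //; lra.
Qed.

Let TSP n : [/\ Tbd n < T n.+1, x (T n.+1) = 0 &
  forall u, Tbd n <= u -> u < T n.+1 -> x u <> 0].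
Proof. by have [T0 Tx] := TbdP n; exact: midpoint_hitP. Qed.

Let T_TbdP n : T n <= Tbd n /\
  forall u, T n <= u -> u < Tbd n -> ~ (x u = a \/ x u = b).
Proof.
have a0 := a_lt0; have b0 := b_gt0.
(* [T 0] and [Tbd 0] are both 0, so the half-open interval is empty. *)
case: n => [|n]; first by split=> //= u; lra.
have [Tm xm _] := TSP n; have [T0 _] := TbdP n.
have [mb _ H] := boundary_hitP (le_trans T0 (ltW Tm)) xm.
by split; [exact: ltW|exact: H].
Qed.

Let T_ge0 n : 0 <= T n.
Proof.
have a0 := a_lt0; have b0 := b_gt0.
case: n => [//|n]; have [T0 _] := TbdP n; have [Tm _ _] := TSP n; lra.
Qed.

Let T_ltS n : T n < T n.+1.
Proof. by have [? _] := T_TbdP n; have [? _ _] := TSP n; lra. Qed.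

Let T_nd m n : (m <= n)%N -> T m <= T n.
Proof.
move=> mn; apply: (@homo_leq _ T <=%O) mn => // [y z w|i]; first exact: le_trans.
exact/ltW/T_ltS.
Qed.

(** At a finite limit of the renewal times the path would be discontinuous: it is 0 at each [T n.+1]
    and [a] or [b] at each [Tbd n]. *)
Lemma Tstar_unbounded M : exists n, M < T n.
Proof.
have a0 := a_lt0; have b0 := b_gt0.
apply: contrapT => H.
have TM n : T n <= M by rewrite leNgt; apply/negP => ?; apply: H; exists n.
have ub : has_ubound (range T) by exists M => _ [n _ <-].
have supT : has_sup (range T) by split => //; exists (T 0%N); exists 0%N.
set L := sup (range T).
have TL n : T n <= L by apply: ub_le_sup => //; exists n.
(* Half the distance from 0 to the boundary: two values this close to [x L] cannot be 0 and a
   boundary point. *)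
have e0 : 0 < Num.min (- a) b / 2 by rewrite divr_gt0// lt_min b_gt0 andbT oppr_gt0.
have eb : Num.min (- a) b <= b by rewrite ge_min lexx orbT.
have ea : Num.min (- a) b <= - a by rewrite ge_min lexx.
have L0 : 0 <= L by apply: le_trans (TL 0%N).
have [d d0 Hd] := continuous_path_dist xc L0 e0.
have [_ [n _ <-] nL] := sup_adherent d0 supT.
have [TT _] := T_TbdP n; have [Tm xm _] := TSP n; have [Tb0 xb] := TbdP n.
have TSL := TL n.+1; rewrite -/L in nL.
have := Hd _ (T_ge0 n.+1) _; rewrite xm ltr_norml => /(_ ltac:(lra)).
have := Hd _ Tb0 _; rewrite ltr_norml => /(_ ltac:(lra)).
rewrite !ltr_norml; case: xb => ->; lra.
Qed.

(** * Occupation times between renewals *)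

Local Notation TLn := (TL a b x g h).
Local Notation V := (Vbar g h).
Local Notation inv := (Vbar_inv g h).
Local Notation D t := (gammabar_at x g h a t - gammabar_at x g h b t).
Local Notation G := (gammabar a b x g h).

Let TL_nd m n : (m <= n)%N -> TLn m <= TLn n.
Proof. by move=> mn; apply: hg_nd; [exact: T_ge0|exact: T_nd]. Qed.

(** The index set contains 0, and it is bounded since [h (g u)] exceeds [t] for some [u] that the
    renewal times pass. Hence a maximum exists and the default of [xget] is never taken. *)
Let NL_spec t : 0 <= t ->
  TLn (NL a b x g h t) <= t < TLn (NL a b x g h t).+1.
Proof.
have a0 := a_lt0; have b0 := b_gt0.
move=> t0.
have ex : exists n, TLn n <= t by exists 0%N; rewrite /TL/= hg0.
have [u u0 tu] := hg_up t; have [n un] := Tstar_unbounded u.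
have bnd m : TLn m <= t -> (m <= n)%N.
  move=> mt; rewrite leqNgt; apply/negP => nm.
  have := TL_nd (ltnW nm); have := hg_nd u0 (ltW un).
  rewrite /TL in mt *; lra.
have [N NP Nmax] := @ex_maxnP (fun n => TLn n <= t) n ex bnd.
rewrite /NL; case: xgetP => [m _ [mt mmax]|/(_ N)[]]; last first.
  by split=> // m mt; exact: Nmax.
by rewrite mt/= ltNge; apply/negP => /mmax; rewrite ltnn.
Qed.

Let G_V u : 0 <= u -> G (V u) = h (g u).
Proof.
have a0 := a_lt0; have b0 := b_gt0.
move=> u0; apply: gammabar_Vbar => //; first by apply/eqP; lra.
exact: flat_off_boundary.
Qed.

(** Before [Tbd n] the path is off the boundary; from there until [T n.+1] it keeps the sign it has
    at [Tbd n]. *)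
Let no_opposite n u : T n <= u -> u <= T n.+1 ->
  (x (Tbd n) = a -> x u <> b) /\ (x (Tbd n) = b -> x u <> a).
Proof.
have a0 := a_lt0; have b0 := b_gt0.
move=> Tu uT; have [TT offT] := T_TbdP n; have [Tm xm nz] := TSP n.
have [T0 _] := TbdP n.
have [ub|bu] := ltP u (Tbd n).
  by have := offT _ Tu ub; split=> _ xu; apply: H; [right|left].
move: uT; rewrite le_eqVlt => /predU1P[->|uT]; first by rewrite xm; split=> _; lra.
have : (0 < x (Tbd n)) = (0 < x u).
  apply: continuous_path_sign => // v vb vu; apply: nz => //; lra.
by move=> sg; split=> xb xu; move: sg; rewrite xb xu; lra.
Qed.

(** On this stretch only one of the two occupation times can grow, so their difference moves by plus
    or minus their sum. *)
Let D_step n s t : V (T n) <= s -> s <= t -> t <= V (T n.+1) ->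
  D t - D s = theta a b x n.+1 * (G t - G s).
Proof.
have a0 := a_lt0; have b0 := b_gt0.
move=> Vs st tV.
have Tn0 := T_ge0 n; have V0 := Vbar_ge hg_nd hg0 Tn0.
have s0 : 0 <= s by lra.
(* The inverse clock takes [u] back between [T n] and [T n.+1], where only one end can be
   visited. *)
have opp u : s < u -> u <= t ->
  (x (Tbd n) = a -> Xbar x g h u <> b) /\ (x (Tbd n) = b -> Xbar x g h u <> a).
  move=> su ut; apply: no_opposite.
    by rewrite -(Vbar_invK hg_nd hg0 Tn0); apply: Vbar_inv_nd => //; lra.
  by rewrite -(Vbar_invK hg_nd hg0 (T_ge0 n.+1)); apply: Vbar_inv_nd => //; lra.
rewrite /theta/=; have [_ [xa|xb]] := TbdP n.
  have C : gammabar_at x g h b t = gammabar_at x g h b s.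
    by apply: gammabar_at_const => // u su ut; have [+ _] := opp u su ut; exact.
  by rewrite xa eqxx /gammabar C; lra.
have C : gammabar_at x g h a t = gammabar_at x g h a s.
  by apply: gammabar_at_const => // u su ut; have [_] := opp u su ut; exact.
by rewrite xb ifF ?eqxx ?/gammabar ?C; [lra|apply/eqP; lra].
Qed.

Let D_V n : D (V (T n)) =
  \sum_(1 <= j < n.+1) theta a b x j * eL a b x g h j.
Proof.
have a0 := a_lt0; have b0 := b_gt0.
elim: n => [|n IH].
  by rewrite big_geq//= Vbar0// !gammabar_at0// subrr.
(* [G_V] turns the increments of [TL] into increments of [G] between clock times of renewals. *)
rewrite big_nat_recr//= -IH /eL/= /TL -!G_V ?T_ge0//.
rewrite -D_step ?lexx//; first lra.
by have := Vbar_incr hg_nd (T_ge0 n) (ltW (T_ltS n)); have := T_ltS n; lra.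
Qed.

(** Supplies the continuity by which [G] takes the value [t] at [rbar t]. *)
Let G_lip s t : 0 <= s -> s <= t -> 0 <= G t - G s <= 2 * (t - s).
Proof.
have a0 := a_lt0; have b0 := b_gt0.
move=> s0 st; have := gammabar_at_lip xc hg_nd hg0 a s0 st.
have := gammabar_at_lip xc hg_nd hg0 b s0 st; rewrite /gammabar; lra.
Qed.

(** The inverse local time at [t] falls between the clock times of [T N] and [T N.+1]. The sum
    collects the completed stretches, the last term the current one. *)
Lemma local_time_difference t : 0 <= t ->
  let r := rbar a b x g h t in
  let N := NL a b x g h t in
  D r = \sum_(1 <= j < N.+1) theta a b x j * eL a b x g h j
        + theta a b x N.+1 * (t - TLn N).
Proof.
have a0 := a_lt0; have b0 := b_gt0.
move=> t0 r N.
have /andP[Nt tN] := NL_spec t0; rewrite -/N in Nt tN.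
have GN := G_V (T_ge0 N); have GN1 := G_V (T_ge0 N.+1).
have VN0 := Vbar_ge hg_nd hg0 (T_ge0 N); have TN0 := T_ge0 N.
have VN10 := Vbar_ge hg_nd hg0 (T_ge0 N.+1); have TN10 := T_ge0 N.+1.
set S := [set s | 0 <= s /\ t < G s].
have SN1 : S (V (T N.+1)) by split; [lra|rewrite GN1].
have S0 : S !=set0 by exists (V (T N.+1)).
have Sb : lbound S (V (T N)).
  move=> s [s0 ts]; rewrite leNgt; apply/negP => sV.
  by have := G_lip s0 (ltW sV); move: Nt; rewrite GN /TL; lra.
have Vr : V (T N) <= r by exact: lb_le_inf.
have hb : has_lbound S by exists (V (T N)).
have rV : r <= V (T N.+1) by exact: ge_inf.
have r0 : 0 <= r by lra.
have Gr : G r = t.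
  apply/eqP; rewrite eq_le; apply/andP; split; rewrite leNgt; apply/negP => Gt.
    have [r00|r_gt0] := eqVneq r 0.
      by move: Gt; rewrite r00 /gammabar !gammabar_at0//; lra.
    have {}r_gt0 : 0 < r by rewrite lt_neqAle eq_sym r_gt0.
    (* With Lipschitz constant 2, going back by a quarter of the gap loses at most half of it, so
       [r - e] still belongs to [S]; the minimum keeps it nonnegative. *)
    pose e := Num.min r ((G r - t) / 4).
    have e0 : 0 < e by rewrite lt_min r_gt0/=; lra.
    have er : e <= r by rewrite ge_min lexx.
    have eG : e <= (G r - t) / 4 by rewrite ge_min lexx orbT.
    have re : 0 <= r - e by lra.
    have rer : r - e <= r by lra.
    have := G_lip re rer => lip.
    have : r <= r - e by apply: ge_inf => //; split => //; lra.
    lra.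
  (* So close to [r], [G] rises by less than [t - G r], which contradicts [t < G s]. *)
  have [s [s0 ts] sr] : exists2 s : R, S s & s < r + (t - G r) / 2.
    by apply: inf_lt => //; rewrite -/r; lra.
  have rs : r <= s by exact: ge_inf.
  have := G_lip r0 rs; lra.
(* From [V (T N)] to [r] the total occupation time grows from [TL N] to [t]. *)
have := D_step Vr (lexx r) rV; have := D_step (lexx _) Vr rV.
rewrite D_V Gr GN /TL; lra.
Qed.

End pathwise.

(** * Almost sure properties *)

(** Intersecting covers of measure at most [1 / (n + 1)] gives a null cover. *)
Lemma negligible_small d (T : measurableType d) (R : realType)
    (P : {measure set T -> \bar R}) (Z : set T) :
  (forall e : R, 0 < e ->
     exists N, [/\ measurable N, Z `<=` N & (P N <= e%:E)%E]) ->
  P.-negligible Z.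
Proof.
move=> H; have /choice[N HN] : forall n : nat, exists N,
    [/\ measurable N, Z `<=` N & (P N <= (n.+1%:R^-1 : R)%:E)%E].
  by move=> n; apply: H; rewrite invr_gt0.
have mN : measurable (\bigcap_n N n).
  by apply: bigcapT_measurable => n; have [] := HN n.
exists (\bigcap_n N n); split => //; last first.
  by move=> w Zw n _; have [_ + _] := HN n; exact.
apply/eqP; rewrite -measure_le0; apply/lee_addgt0Pr => e e0; rewrite add0e.
have [n ne] : exists n : nat, n.+1%:R^-1 < e.
  by have [n] := ltr_add_invr e0; rewrite add0r; exists n.
apply: (@le_trans _ _ (P (N n))).
  apply: le_measure; rewrite ?inE//; first by have [] := HN n.
  by move=> w; exact.
by have [_ _ /le_trans] := HN n; apply; rewrite lee_fin ltW.
Qed.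

(** Integer bounds suffice, which leaves a countable union of negligible sets. *)
Lemma ae_unbounded d (T : measurableType d) (R : realType)
    (P : probability T R) (Y : R -> T -> R) :
  (forall K : nat,
     P.-negligible [set w | forall t : R, 0 <= t -> Y t w <= K%:R]) ->
  {ae P, forall w, forall M : R, exists2 t : R, 0 <= t & M < Y t w}.
Proof.
move=> bounded_negl.
have : {ae P, forall w, forall K : nat, ~ (forall t : R, 0 <= t -> Y t w <= K%:R)}.
  apply: ae_foralln => K; apply: negligibleS (bounded_negl K) => w /=.
  by move/contrapT.
apply: filterS => w Hw M; apply: contrapT => nM.
apply: (Hw (Num.bound `|M|)) => t t0.
have : Y t w <= M by rewrite leNgt; apply/negP => ?; apply: nM; exists t.
by move=> /le_trans; apply; rewrite (le_trans (ler_norm M))// ltW// archi_boundP.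
Qed.

Lemma measurable_ltr_mulr (R : realType) (c s : R) :
  measurable [set y : R | s < c * y].
Proof.
rewrite (_ : [set _ | _] = ( *%R c) @^-1` `]s, +oo[).
  by rewrite -[_ @^-1` _]setTI; exact: mulrl_measurable.
by apply/seteqP; split => y /=; rewrite in_itv/= andbT.
Qed.

(** [p] is uniform in [s] by scaling: between one and two standard deviations the density is at
    least [exp (-2) / (s * sqrt (2 * pi))], on an interval of length [s]. *)
Lemma normal_prob_tail (R : realType) : exists2 p : R, 0 < p &
  forall c s : R, (c = 1 \/ c = -1) -> 0 < s ->
    (p%:E <= normal_prob 0 s [set y | (s < c * y)%R])%E.
Proof.
pose p : R := (Num.sqrt (pi *+ 2))^-1 * expR (- 2).
exists p.
  by rewrite mulr_gt0 ?expR_gt0// invr_gt0 sqrtr_gt0 mulrn_wgt0// pi_gt0.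
move=> c s c1 s0; have sn0 : s != 0 by rewrite gt_eqF.
set I : set R := [set y | s < c * y <= 2 * s].
have IE : exists2 i : interval R, I = [set` i] & lebesgue_measure I = s%:E.
  rewrite /I; case: (c1) => ->.
    have E : [set y | s < 1 * y <= 2 * s] = `]s, 2 * s]%classic.
      apply/seteqP; split => y /=; rewrite in_itv/=; lra.
    exists `]s, 2 * s] => //.
    rewrite E lebesgue_measure_itv/= lte_fin ifT; last by lra.
    by rewrite -EFinB; congr EFin; lra.
  have E : [set y | s < -1 * y <= 2 * s] = `[- (2 * s), - s[%classic.
    apply/seteqP; split => y /=; rewrite in_itv/=; lra.
  exists `[- (2 * s), - s[ => //.
  rewrite E lebesgue_measure_itv/= lte_fin ifT; last by lra.
  by rewrite -EFinB; congr EFin; lra.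
have [i Ii muI] := IE.
have mI : measurable I by rewrite Ii; exact: measurable_itv.
apply: (@le_trans _ _ (normal_prob 0 s I)); last first.
  by apply: le_measure; rewrite ?inE//; [exact: measurable_ltr_mulr|move=> y /= /andP[]].
pose q : R := (s * Num.sqrt (pi *+ 2))^-1 * expR (- 2).
apply: (@le_trans _ _ (\int[lebesgue_measure]_(x in I) (cst q%:E x))%E).
  rewrite integral_cst//= muI -EFinM lee_fin le_eqVlt; apply/orP; left; apply/eqP.
  have S0 : Num.sqrt (pi *+ 2) != 0 :> R.
    by rewrite gt_eqF// sqrtr_gt0 mulrn_wgt0// pi_gt0.
  rewrite /q /p; move: S0; set S := Num.sqrt _ => S0.
  by field; rewrite S0 sn0.
rewrite /normal_prob; apply: ge0_le_integral => //.
- by move=> x _; rewrite lee_fin mulr_ge0 ?expR_ge0// invr_ge0 mulr_ge0 ?sqrtr_ge0// ltW.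
- by apply: measurable_funTS; apply/measurable_EFinP; exact: measurable_normal_pdf.
move=> x /= /andP[sx x2]; rewrite lee_fin normal_pdfE// /q.
rewrite ler_pM ?expR_ge0//.
- by rewrite invr_ge0 mulr_ge0 ?sqrtr_ge0// ltW.
- by rewrite /normal_peak -mulrnAr sqrtrM ?sqr_ge0// sqrtr_sqr gtr0_norm.
rewrite /normal_fun ler_expR subr0 mulNr lerN2 ler_pdivrMr; last first.
  by rewrite mulrn_wgt0// exprn_gt0.
have -> : x ^+ 2 = (c * x) ^+ 2 by case: c1 => ->; ring.
by move: (c * x) sx x2 => z sx x2; nra.
Qed.

(** * Negligible sets from independent increments *)

Section increments.
Context d (T : measurableType d) (R : realType) (P : probability T R).

(* If Z forces infinitely many independent increments of B, taken along a well
   chosen sequence of times, to be no larger than their standard deviation, up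
   to exceptional events C of small probability, then Z is negligible. *)
Lemma brownian_increments_negligible (B : R -> {RV P >-> R}) (c s0 : R)
    (D : set R) (Z : set T) :
  brownian_motion B -> (c = 1 \/ c = -1) -> 0 <= s0 -> D s0 ->
  (forall e : R, 0 < e -> forall s, 0 <= s -> D s ->
     exists s' C, [/\ s < s', D s', measurable C, (P C <= e%:E)%E &
       forall w, Z w -> ~ C w ->
         c * (B s' w - B s w) <= Num.sqrt (2 * (s' - s))]) ->
  P.-negligible Z.
Proof.
move=> bm c1 s00 Ds0 step; apply: negligible_small => e e0.
have [p p0 tail] := normal_prob_tail R.
have p1 : p <= 1.
  rewrite -lee_fin; apply: le_trans (tail 1 1 (or_introl erefl) ltr01) _.
  by apply: probability_le1; exact: measurable_ltr_mulr.
(* [n] increments are all small with probability at most [(1 - p) ^+ n]; half of [e] is reserved for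
   this, the other half for the exceptional events. *)
have [n qn] : exists n : nat, (1 - p) ^+ n <= e / 2.
  have [->|q0] := eqVneq (1 - p) 0; first by exists 1%N; rewrite expr1; lra.
  have := @cvg_expr R (1 - p); rewrite ger0_norm ?subr_ge0// => /(_ ltac:(lra)).
  move=> /cvgrPdist_le/(_ (e / 2) ltac:(lra))[n _ Hn]; exists n.
  have := Hn n (leqnn _) => /=; rewrite sub0r normrN ger0_norm//.
  by rewrite exprn_ge0// subr_ge0.
pose dlt := e / 2 / n.+1%:R.
have dlt0 : 0 < dlt by rewrite !divr_gt0.
(* [F s] returns the next time and its exceptional event; iterating it from [s0] gives the sequence
   [t]. *)
have /choice[F HF] : forall s : R, exists sC : R * set T, 0 <= s -> D s ->
    [/\ s < sC.1, D sC.1, measurable sC.2, (P sC.2 <= dlt%:E)%E &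
       forall w, Z w -> ~ sC.2 w ->
         c * (B sC.1 w - B s w) <= Num.sqrt (2 * (sC.1 - s))].
  move=> s; have [[s_ge0 Ds]|ns] := pselect (0 <= s /\ D s); last first.
    by exists (0, set0) => ? ?; exfalso; apply: ns.
  by have [s' [C HC]] := step _ dlt0 _ s_ge0 Ds; exists (s', C).
pose t := fix t (k : nat) := if k is k'.+1 then (F (t k')).1 else s0.
have tD k : 0 <= t k /\ D (t k).
  elim: k => [//|k [tk Dk]] /=; have [lt_t Dt _ _ _] := HF _ tk Dk.
  by split => //; rewrite (le_trans tk)// ltW.
have tS k : t k < t k.+1 by have [tk Dk] := tD k; have [] := HF _ tk Dk.
pose C k := (F (t k)).2.
have mC k : measurable (C k) by have [tk Dk] := tD k; have [] := HF _ tk Dk.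
have PC k : (P (C k) <= dlt%:E)%E by have [tk Dk] := tD k; have [] := HF _ tk Dk.
have ZC k w : Z w -> ~ C k w ->
    c * (B (t k.+1) w - B (t k) w) <= Num.sqrt (2 * (t k.+1 - t k)).
  by have [tk Dk] := tD k; have [_ _ _ _] := HF _ tk Dk; exact.
pose A k : set R := ~` [set y | Num.sqrt (2 * (t k.+1 - t k)) < c * y].
have mA k : measurable (A k) by apply: measurableC; exact: measurable_ltr_mulr.
pose Y k : T -> R := B (t k.+1) \- B (t k).
have mY k : measurable_fun setT (Y k) by exact: measurable_funB.
have mE k : measurable (Y k @^-1` A k).
  by rewrite -[_ @^-1` _]setTI; exact: mY.
have PE k : (P (Y k @^-1` A k) <= (1 - p)%:E)%E.
  have [tk _] := tD k.
  rewrite (bm_normal bm tk (tS k) (mA k)).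
  have sd0 : 0 < Num.sqrt (2 * (t k.+1 - t k)).
    by rewrite sqrtr_gt0; have := tS k; lra.
  rewrite /A probability_setC; last exact: measurable_ltr_mulr.
  by rewrite EFinB; apply: leeB => //; exact: tail.
(* Independence turns the probability into a product of factors at most [1 - p]. *)
have PI : (P (\bigcap_(i in [set: 'I_n]) (Y i @^-1` A i)) <= (e / 2)%:E)%E.
  have := bm_independent bm (t := t) s00 (fun i => ltW (tS i)).
  move=> /(_ n).
  move=> /(_ (fun i => A i) (fun i => mA i)) ->.
  apply: (@le_trans _ _ (\prod_(i < n) (1 - p))%:E); last first.
    by rewrite prodr_const card_ord lee_fin.
  suff /andP[] : (0 <= \prod_(i < n) P (Y i @^-1` A i) <= (\prod_(i < n) (1 - p))%:E)%E by [].
  elim/big_ind2 : _ => [|u v u' v' /andP[u0 uv] /andP[u0' uv']|i _].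
  - by rewrite lee_fin ler01 lexx.
  - by rewrite mule_ge0// EFinM lee_pmul.
  - by rewrite measure_ge0 PE.
pose W := \big[setU/set0]_(i < n) C i.
have mW : measurable W by apply: bigsetU_measurable => i _; exact: mC.
have PW : (P W <= (e / 2)%:E)%E.
  apply: (le_trans (Boole_inequality _ (fun i _ => mC i))).
  apply: (@le_trans _ _ (\sum_(i < n) dlt%:E)%E); first by apply: lee_sum => i _; exact: PC.
  rewrite sumEFin sumr_const card_ord lee_fin.
  have -> : e / 2 = dlt *+ n.+1 by rewrite -[RHS]mulr_natr /dlt divfK ?pnatr_eq0.
  by rewrite mulrS lerDr ltW.
have mI : measurable (\bigcap_(i in [set: 'I_n]) (Y i @^-1` A i)).
  by apply: fin_bigcap_measurable => //; exact: finite_finset.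
exists (W `|` \bigcap_(i in [set: 'I_n]) (Y i @^-1` A i)); split.
- exact: measurableU.
- move=> w Zw; have [Ww|nW] := pselect (W w); first by left.
  right=> i _ /=; apply/negP; rewrite -leNgt; apply: ZC => // Ci; apply: nW.
  by rewrite /W -bigcup_mkord; exists i => //=; exact: ltn_ord.
- apply: (le_trans (measureU2 _ mW mI)).
  by rewrite [e in leRHS]splitr EFinD leeD.
Qed.

End increments.

(** * Unboundedness and absence of one-sided extrema for Brownian paths *)

Section brownian_paths.
Context d (T : measurableType d) (R : realType) (P : probability T R).

(** Continuity of the measure from above. *)
Lemma nonincreasing_small (F : nat -> set T) (e : R) : 0 < e ->
  (forall n, measurable (F n)) -> (forall m n, (m <= n)%N -> F n `<=` F m) ->
  P.-negligible (\bigcap_n F n) -> exists n, (P (F n) <= e%:E)%E.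
Proof.
move=> e0 mF ndF F0.
have mI : measurable (\bigcap_n F n) by exact: bigcapT_measurable.
have cF : (P \o F) n @[n --> \oo] --> P (\bigcap_n F n).
  apply: nonincreasing_cvg_mu => //.
    by rewrite (le_lt_trans (probability_le1 _ _))// ltry.
  by move=> m n mn; apply/subsetPset/ndF.
rewrite (measure_negligible mI F0) in cF.
have /fine_cvgP[fP /cvgrPdist_le/(_ _ e0)[n _ Hn]] := cF.
exists n; have := Hn n (leqnn n); rewrite /= sub0r normrN ger0_norm ?fine_ge0//.
by rewrite -lee_fin fineK// fin_num_measure.
Qed.

Lemma measurable_norm_gt (Y : T -> R) (K : R) : measurable_fun setT Y ->
  measurable [set w | K < `|Y w|].
Proof.
move=> mY; have mN : measurable_fun setT (fun w => `|Y w|).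
  by apply: measurableT_comp.
rewrite (_ : [set _ | _] = (fun w => `|Y w|) @^-1` `]K, +oo[).
  by rewrite -[_ @^-1` _]setTI; exact: mN.
by apply/seteqP; split => w /=; rewrite in_itv/= andbT.
Qed.

Lemma random_variable_tight (Y : T -> R) (e : R) : measurable_fun setT Y ->
  0 < e -> exists K : R, 0 <= K /\ (P [set w | (K < `|Y w|)%R] <= e%:E)%E.
Proof.
move=> mY e0.
have [n Pn] : exists n : nat, (P [set w | (n%:R < `|Y w|)%R] <= e%:E)%E.
  apply: (@nonincreasing_small (fun n : nat => [set w | n%:R < `|Y w|])) => //.
  - by move=> n; exact: measurable_norm_gt.
  - by move=> m n mn w /=; apply: le_lt_trans; rewrite ler_nat.
  rewrite (_ : \bigcap_n _ = set0); first exact: negligible_set0.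
  rewrite -subset0 => w /(_ (Num.bound `|Y w|) I) /=.
  by rewrite ltNge => /negP; apply; rewrite ltW// archi_boundP.
by exists n%:R.
Qed.

Variable B : R -> {RV P >-> R}.
Hypothesis bm : brownian_motion B.

(** If [c * B] stays below [M] and [|B s|] is at most [K], every increment from [s] is at most
    [M + K], which a long enough time step makes smaller than the standard deviation. *)
Lemma brownian_unbounded (c M : R) : c = 1 \/ c = -1 ->
  P.-negligible [set w | forall t, 0 <= t -> c * B t w <= M].
Proof.
move=> c1.
apply: (@brownian_increments_negligible _ _ _ _ B c 0 setT _ bm c1) => //.
move=> e e0 s s0 _.
have [K [K0 PK]] := @random_variable_tight (B s) e (measurable_funPT _) e0.
(* A time step [u ^+ 2] has standard deviation at least [u], and [u] dominates [M + K]; the added 1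
   keeps the step positive. *)
pose u := `|M| + K + 1.
have M0 := normr_ge0 M; have MM := ler_norm M.
have u1 : 1 <= u by rewrite /u; lra.
exists (s + u ^+ 2), [set w | K < `|B s w|]; split => //.
- by rewrite ltrDl exprn_gt0//; lra.
- exact: measurable_norm_gt.
move=> w Zw /negP; rewrite -leNgt => BK.
have su : 0 <= s + u ^+ 2 by rewrite addr_ge0// sqr_ge0.
have cB := Zw _ su.
have cBs : - K <= c * B s w.
  by move: BK; rewrite ler_norml; case: c1 => ->; lra.
apply: (@le_trans _ _ u); first by rewrite /u; lra.
rewrite (addrC s) addrK -[leLHS]ger0_norm -?sqrtr_sqr; last lra.
by rewrite ler_sqrt; nra.
Qed.

(** If [c * B] is minimal at [t], its increment from [s] to a time [s'] is at most
    [c * (B s' - B t)]. By continuity this is small for [s'] near [t], while the standard deviation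
    of the increment is not. *)
Lemma brownian_not_left_extremal (c t s0 : R) : c = 1 \/ c = -1 ->
  0 <= s0 -> s0 < t ->
  P.-negligible [set w | forall s, s0 <= s -> s <= t -> c * B t w <= c * B s w].
Proof.
move=> c1 s00 st0.
apply: (@brownian_increments_negligible _ _ _ _ B c s0 [set s | s0 <= s < t] _ bm c1) => //.
  by rewrite /= lexx.
move=> e e0 s s_ge0 /= /andP[s0s st].
(* These times tend to [t] and start at the midpoint of [s] and [t], so that [2 * (v m - s)] is at
   least [t - s], the square of [eps] below. *)
pose v (m : nat) : R := t - (t - s) / m.+2%:R.
have t0 : 0 <= t by lra.
have vb m : (s + t) / 2 <= v m < t.
  have : 0 < (m.+2%:R^-1 : R) <= 2^-1 by rewrite invr_gt0 ltr0n/= lef_pV2 ?posrE// ler_nat.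
  rewrite /v; move: (m.+2%:R^-1) => q /andP[q0 q2]; have u0 : 0 < t - s by lra.
  have := ler_wpM2l (ltW u0) q2; have := mulr_gt0 u0 q0; lra.
pose eps := Num.sqrt (t - s).
have eps0 : 0 < eps by rewrite sqrtr_gt0; lra.
pose E m := [set w | eps < `|B t w - B (v m) w|].
have mE m : measurable (E m).
  by apply: measurable_norm_gt; exact: measurable_funB.
(* The events [F n] decrease, and a path in all of them is discontinuous at [t]. *)
pose F n := \bigcup_(m in [set m | (n <= m)%N]) E m.
have mF n : measurable (F n) by apply: bigcup_measurable.
have [n Pn] : exists n, (P (F n) <= e%:E)%E.
  apply: nonincreasing_small => //.
    by move=> m n mn w [k /= nk Ek]; exists k => //=; exact: leq_trans nk.
  apply: negligibleS (bm_continuous bm) => w /= Fw Bc.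
  have [d' d0 Hd] := continuous_path_dist Bc t0 eps0.
  have [N HN] : exists N : nat, (t - s) / N.+1%:R < d'.
    have ts0 : 0 < t - s by lra.
    have [N] := ltr_add_invr (divr_gt0 d0 ts0); rewrite add0r => HN.
    by exists N; rewrite mulrC -ltr_pdivlMr.
  have [m /= Nm] := Fw N I; rewrite /E/= ltNge => /negP; apply.
  rewrite distrC ltW//; apply: Hd; first by have := vb m; lra.
  rewrite /v addrAC subrr sub0r normrN ger0_norm; last by rewrite divr_ge0//; lra.
  apply: le_lt_trans HN; rewrite ler_wpM2l//; first lra.
  by rewrite lef_pV2 ?posrE// ler_nat leqW// ltnS.
exists (v n), (F n); have vn := vb n; split => //; [lra|lra|].
move=> w Zw Fn.
have nE : `|B t w - B (v n) w| <= eps.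
  by rewrite leNgt; apply/negP => En; apply: Fn; exists n => /=.
have cB := Zw s s0s (ltW st).
have cE : - eps <= c * (B t w - B (v n) w).
  by move: nE; rewrite ler_norml; case: c1 => ->; lra.
apply: (@le_trans _ _ eps); first by move: cE; rewrite !mulrBr; lra.
by rewrite /eps ler_sqrt; lra.
Qed.

End brownian_paths.

(** Exponential Markov inequality at [lambda = 1], where [lambda] to the power [alpha] is 1: the
    probability of [H t <= K] is at most [exp (K - t)]. *)
Lemma stable_subordinator_unbounded d (T : measurableType d) (R : realType)
    (P : probability T R) (alpha : R) (H : R -> {RV P >-> R}) :
  stable_subordinator alpha H ->
  {ae P, forall w, forall M : R, exists2 t : R, 0 <= t & M < H t w}.
Proof.
move=> sub; apply: ae_unbounded => K.
apply: negligible_small => e e0.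
have [t t0 te] : exists2 t : R, 0 <= t & expR (K%:R - t) <= e.
  exists (Num.max 0 (K%:R - ln e)); first by rewrite le_max lexx.
  rewrite -[leRHS]lnK ?posrE// ler_expR.
  have mx : K%:R - ln e <= Num.max 0 (K%:R - ln e) by rewrite le_max lexx orbT.
  lra.
pose N := [set w | H t w <= K%:R].
have mN : measurable N.
  rewrite (_ : N = H t @^-1` `]-oo, K%:R]); last first.
    by apply/seteqP; split => w /=; rewrite in_itv.
  by rewrite -[_ @^-1` _]setTI; exact: measurable_funPT.
exists N; split => //; first by move=> w; exact.
have := sub_laplace sub t0 ltr01; rewrite powR1 mulr1 unlock => laplace.
have mexp : measurable_fun setT (fun w => expR (- (1 * H t w))).
  apply: measurableT_comp => //; apply: measurableT_comp => //.
  exact: measurable_funM.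
have le1 : ((expR (- K%:R))%:E * P N <= (expR (- t))%:E)%E.
  have mind : measurable_fun setT (fun w => (\1_N w)%:E : \bar R).
    by apply/measurable_EFinP; exact: measurable_indic.
  have -> : ((expR (- K%:R))%:E * P N =
      \int[P]_w ((expR (- K%:R))%:E * (\1_N w)%:E))%E.
    by rewrite ge0_integralZl ?integral_indic ?setIT ?lee_fin ?expR_ge0.
  rewrite -laplace.
  apply: ge0_le_integral => //.
  - exact: measurable_funeM.
  - exact/measurable_EFinP.
  move=> w _; rewrite -EFinM lee_fin indicE.
  have [wN|_] := boolP (w \in N); last by rewrite mulr0 expR_ge0.
  by move: wN; rewrite inE /N/= mulr1 mul1r ler_expR lerN2.
apply: (@le_trans _ _ ((expR K%:R)%:E * ((expR (- K%:R))%:E * P N))%E).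
  by rewrite muleA -EFinM -expRD subrr expR0 mul1e.
apply: (le_trans (lee_wpmul2l _ le1)); first by rewrite lee_fin expR_ge0.
by rewrite -EFinM -expRD lee_fin.
Qed.

(* If x t = a then, shortly before t, gb is constant, so that
   B t - B s = (a - x s) - (ga t - ga s) <= 0; symmetrically at b. *)
Lemma left_extremal_at_boundary (R : realType) (a b : R) (x B ga gb : R -> R)
    (t : R) :
  a < b -> continuous_path x -> (forall s : R, 0 <= s -> a <= x s <= b) ->
  boundary_local_time x a ga -> boundary_local_time x b gb ->
  (forall s : R, 0 <= s -> x s = x 0 + B s + ga s - gb s) ->
  0 < t -> x t = a \/ x t = b ->
  exists n : nat, exists2 c : R, c = 1 \/ c = -1 &
    forall s : R, t - t / n.+2%:R <= s -> s <= t -> c * B t <= c * B s.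
Proof.
move=> ab xc xr lta ltb sk t0 xt.
have e0 : 0 < b - a by lra.
have [d d0 Hd] := continuous_path_dist xc (ltW t0) e0.
(* The neighbourhoods are indexed by integers so that their exceptional sets can be united; [n.+2]
   keeps the left endpoint at a nonnegative time. *)
have [n] := ltr_add_invr (divr_gt0 d0 t0); rewrite add0r => Hn.
have nd : t / n.+2%:R < d.
  rewrite mulrC -ltr_pdivlMr//; apply: le_lt_trans Hn.
  by rewrite lef_pV2 ?posrE// ler_nat.
have nt : t / n.+2%:R <= t by rewrite ler_pdivrMr// ler_peMr ?ler1n// ltW.
exists n; move: (t / n.+2%:R) nd nt => v nd nt.
have near_t (s : R) : t - v <= s -> s <= t -> 0 <= s /\ `|x s - x t| < b - a.
  move=> ls st; have s0 : 0 <= s by lra.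
  by split=> //; apply: Hd => //; rewrite ler0_norm; lra.
have xrt := xr _ (ltW t0).
have skt := sk _ (ltW t0).
case: xt => xt.
  exists 1; first by left.
  move=> s ls st; have [s0 _] := near_t _ ls st.
  have gbst : gb s = gb t.
    apply: (lt_support ltb) => // u su ut; apply/eqP => xu.
    have lu : t - v <= u by lra.
    have [_] := near_t _ lu ut; rewrite xu xt ltr_norml; lra.
  have := lt_nondecreasing lta s0 st; have := sk _ s0; have := xr _ s0.
  by rewrite skt in xt *; lra.
exists (-1); first by right.
move=> s ls st; have [s0 _] := near_t _ ls st.
have gast : ga s = ga t.
  apply: (lt_support lta) => // u su ut; apply/eqP => xu.
  have lu : t - v <= u by lra.
  have [_] := near_t _ lu ut; rewrite xu xt ltr_norml; lra.
have := lt_nondecreasing ltb s0 st; have := sk _ s0; have := xr _ s0.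
by rewrite skt in xt *; lra.
Qed.

(** * Lebesgue-null boundary times of the reflected motion *)

Section boundary_null.
Context d (T : measurableType d) (R : realType) (P : probability T R).
Local Notation mu := (@lebesgue_measure R).

(** Being on the boundary at [t] makes [B t] extremal over one of countably many left neighbourhoods
    of [t], each a negligible event. *)
Lemma reflected_not_at_boundary (a b : R) (X B ga gb : R -> {RV P >-> R}) (t : R) :
  a < b -> reflected_brownian_motion a b X B ga gb -> 0 < t ->
  P.-negligible [set w | X t w = a \/ X t w = b].
Proof.
move=> ab [bm _ Xc Xr La Lb sk] t0.
have ext c : c = 1 \/ c = -1 -> {ae P, forall w, forall n : nat,
    ~ (forall s : R, t - t / n.+2%:R <= s -> s <= t -> c * B t w <= c * B s w)}.
  move=> c1; apply: ae_foralln => n.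
  have nt : 0 < t / n.+2%:R by rewrite divr_gt0.
  have nt' : t / n.+2%:R <= t by rewrite ler_pdivrMr// ler_peMr ?ler1n// ltW.
  have s0 : 0 <= t - t / n.+2%:R by rewrite subr_ge0.
  have st : t - t / n.+2%:R < t by rewrite ltrBlDr ltrDl.
  apply: negligibleS (brownian_not_left_extremal bm c1 s0 st) => w /=.
  by move/contrapT.
suff : {ae P, forall w, ~ (X t w = a \/ X t w = b)}.
  by apply: negligibleS => w /= H; apply.
near=> w => Xt.
have wc : continuous_path (fun t => X t w) by near: w.
have wr : forall s : R, 0 <= s -> a <= X s w <= b by near: w.
have wa : boundary_local_time (fun t => X t w) a (fun t => ga t w) by near: w.
have wb : boundary_local_time (fun t => X t w) b (fun t => gb t w) by near: w.
have wsk : forall s : R, 0 <= s -> X s w = X 0 w + B s w + ga s w - gb s w.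
  by near: w.
have [n [c c1]] := left_extremal_at_boundary ab wc wr wa wb wsk t0 Xt.
by case: c1 => ->; move: n; near: w; apply: ext; [left|right].
Unshelve. all: by end_near. Qed.

(** Tonelli: null sections at each time give a null set for the product measure, hence null sections
    for almost every [w]. *)
Lemma product_negligible_xsection (S : set (T * R)) : measurable S ->
  (forall t, P.-negligible (ysection S t)) ->
  {ae P, forall w, mu.-negligible (xsection S w)}.
Proof.
move=> mS S0.
have mf : measurable_fun setT (mu \o xsection S) by exact: measurable_fun_xsection.
have : (\int[P]_w `|(mu \o xsection S) w| = 0)%E.
  transitivity ((P \x mu)%E S).
    by apply: eq_integral => w _; rewrite gee0_abs.
  (* Both iterated integrals give the product measure, by uniqueness, so the order of integration
     can be exchanged. *)
  transitivity ((P \x^ mu)%E S).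
    by apply: product_measure_unique => //= ? ? ? ?; rewrite product_measure2E.
  apply: integral0_eq => t _ /=; apply: measure_negligible => //.
  exact: measurable_ysection.
move/(ae_eq_integral_abs _ measurableT mf); apply: negligibleS => w /= nS H.
by apply: nS; apply/negligibleP; [exact: measurable_xsection|exact: H].
Qed.

(* The discretisation S below makes the event X t w = c jointly measurable
   in (w, t); on continuous paths it is exactly that event. *)
Lemma ae_level_set_null (X : R -> {RV P >-> R}) (c : R) :
  {ae P, forall w, continuous_path (fun t => X t w)} ->
  (forall t, 0 < t -> P.-negligible [set w | X t w = c]) ->
  {ae P, forall w, mu.-negligible [set t | 0 <= t /\ X t w = c]}.
Proof.
move=> Xc X0.
pose q (n k : nat) : R := k%:R / n.+1%:R.
pose A (n m k : nat) := [set w | `|X (q n k) w - c| <= m.+1%:R^-1].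
pose S' n m := \bigcup_k (A n m k `*` `[q n k, q n k.+1[%classic).
(* For every [m] and all large [n], the value at the last point of the grid of mesh [1 / (n + 1)]
   not after [t] is within [1 / (m + 1)] of [c]. *)
pose S : set (T * R) := (setT `*` `]0, +oo[%classic) `&`
  \bigcap_m \bigcup_N \bigcap_(n in [set n | (N <= n)%N]) S' n m.
have mA n m k : measurable (A n m k).
  rewrite (_ : A n m k = ~` [set w | m.+1%:R^-1 < `|X (q n k) w - c|]).
    apply: measurableC; apply: (@measurable_norm_gt _ _ _ (fun w => X (q n k) w - c)).
    exact: measurable_funB.
  by apply/seteqP; split => w; rewrite /A/= leNgt => /negP.
have mS' n m : measurable (S' n m).
  by apply: bigcup_measurable => k _; apply: measurableX => //; exact: measurable_itv.
have mS : measurable S.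
  apply: measurableI; first by apply: measurableX => //; exact: measurable_itv.
  apply: bigcapT_measurable => m; apply: bigcup_measurable => N _.
  by apply: bigcap_measurable => //; exists N => /=.
have qD n k : q n k.+1 - q n k = n.+1%:R^-1.
  by rewrite /q -mulrBl -natrB// subSnn mul1r.
have near_q (n : nat) (t d' : R) k : n.+1%:R^-1 < d' -> q n k <= t < q n k.+1 ->
    `|q n k - t| < d'.
  move=> + /andP[]; have := qD n k; move: (q n k) (q n k.+1) (n.+1%:R^-1) => u v r *.
  by rewrite ler0_norm; lra.
have SE w t : continuous_path (fun t => X t w) -> 0 < t -> S (w, t) <-> X t w = c.
  move=> wc t0; split=> [[_ H]|Xt].
    apply/eqP; rewrite -subr_eq0 -normr_le0; apply/ler_addgt0Pr => e e0; rewrite add0r.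
    have e20 : 0 < e / 2 by lra.
    have [m] := ltr_add_invr e20; rewrite add0r => me.
    have [N _ HN] := H m I.
    have [d' d0 Hd] := continuous_path_dist wc (ltW t0) e20.
    have [N'] := ltr_add_invr d0; rewrite add0r => Nd.
    have [k _ [/= Ak tk]] := HN (maxn N N') (leq_maxl _ _).
    have q0 : 0 <= q (maxn N N') k by rewrite divr_ge0.
    have nd : (maxn N N').+1%:R^-1 < d'.
      by apply: le_lt_trans Nd; rewrite lef_pV2 ?posrE// ler_nat ltnS leq_maxr.
    have := Hd _ q0 (near_q _ _ _ _ nd tk); move: Ak; rewrite /A/=.
    rewrite ler_norml ltr_norml ler_norml; move: (m.+1%:R^-1) me => r; lra.
  split; first by split => //=; rewrite in_itv/= t0.
  move=> m _.
  have m0 : 0 < m.+1%:R^-1 :> R by rewrite invr_gt0.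
  have [d' d0 Hd] := continuous_path_dist wc (ltW t0) m0.
  have [N] := ltr_add_invr d0; rewrite add0r => Nd.
  exists N => // n /= Nn.
  have nd : n.+1%:R^-1 < d'.
    by apply: le_lt_trans Nd; rewrite lef_pV2 ?posrE// ler_nat ltnS.
  have n0 : 0 < n.+1%:R :> R by [].
  have nt0 : 0 <= t * n.+1%:R by rewrite mulr_ge0// ltW.
  pose k := Num.truncn (t * n.+1%:R).
  have tk : q n k <= t < q n k.+1.
    by rewrite /q ler_pdivrMr// ltr_pdivlMr//; exact: truncn_itv.
  exists k => //; split => /=; last by rewrite in_itv.
  have q0 : 0 <= q n k by rewrite divr_ge0.
  by rewrite /A/= -{1}Xt ltW//; exact: Hd (near_q _ _ _ _ nd tk).
have : {ae P, forall w, mu.-negligible (xsection S w)}.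
  apply: product_negligible_xsection => // t.
  have [t0|t0] := ltP 0 t; last first.
    rewrite (_ : ysection S t = set0); first exact: negligible_set0.
    rewrite -subset0 => w; rewrite /ysection/= inE => -[[_ /=]].
    by rewrite in_itv/= andbT ltNge t0.
  apply: negligibleS (negligibleU Xc (X0 t t0)) => w; rewrite /ysection/= inE => Swt.
  have [wc|nwc] := pselect (continuous_path (fun t => X t w)); last by left.
  by right; apply/(SE _ _ wc t0).
apply: filterS2 Xc => w wc Sw.
(* [S] only sees positive times; time 0 adds at most one point. *)
have -> : [set t : R | 0 <= t /\ X t w = c] =
    [set t : R | 0 < t /\ X t w = c] `|` [set t | t = 0 /\ X t w = c].
  apply/seteqP; split => t /=.
    by rewrite le_eqVlt => -[/predU1P[<-|t0]]; [right|left].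
  by move=> [[t0 ?]|[-> ?]]; split => //; exact: ltW.
apply: negligibleU.
  apply: negligibleS Sw => t /= [t0 Xt]; rewrite /xsection/= inE.
  by apply/(SE _ _ wc t0).
have n0 : mu.-negligible [set (0 : R)].
  by apply/negligibleP; [exact: measurable_set1|exact: lebesgue_measure_set1].
by apply: negligibleS n0 => t /= [].
Qed.

End boundary_null.

(** * From single paths to almost every path *)

Theorem theorem6 (d : measure_display) (T : measurableType d) (R : realType)
    (P : probability T R) (alpha eta sigma a b : R)
    (X B ga gb H : R -> {RV P >-> R})
    (alpha_gt0 : 0 < alpha) (alpha_le1 : alpha <= 1)
    (eta_gt0 : 0 < eta) (sigma_gt0 : 0 < sigma)
    (a_def : a = - eta / sigma) (b_def : b = eta / sigma)
    (X_rbm : reflected_brownian_motion a b X B ga gb)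
    (X_start : {ae P, forall w, X 0 w = a \/ X 0 w = b})
    (H_stable : stable_subordinator alpha H)
    (H_indep_X : independent_processes H X) :
  {ae P, forall w,
    let x := fun t => X t w in
    let g := fun t => ga t w + gb t w in
    let h := fun t => H t w in
    forall t, 0 <= t ->
      let r := rbar a b x g h t in
      let N := NL a b x g h t in
      gammabar_at x g h a r - gammabar_at x g h b r =
      \sum_(1 <= j < N.+1) theta a b x j * eL a b x g h j
      + theta a b x N.+1 * (t - TL a b x g h N)}.
Proof.
have ab : a < 0 /\ 0 < b.
  have := divr_gt0 eta_gt0 sigma_gt0; rewrite a_def b_def mulNr; lra.
have [a0 b0] := ab; have {}ab : a < b by lra.
have bm := rbm_driver X_rbm.
have B_unb c : c = 1 \/ c = -1 ->
    {ae P, forall w, forall M : R, exists2 t : R, 0 <= t & M < c * B t w}.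
  by move=> c1; apply: ae_unbounded => K; exact: (brownian_unbounded bm).
have null c : c = a \/ c = b -> {ae P, forall w,
    (@lebesgue_measure R).-negligible [set t | 0 <= t /\ X t w = c]}.
  move=> cab; apply: ae_level_set_null; first exact: rbm_continuous X_rbm.
  move=> t t0; apply: negligibleS (reflected_not_at_boundary ab X_rbm t0) => w /= ->.
  by case: cab => ->; [left|right].
(* [w] is chosen before [t], so a single null set serves all [t]. *)
near=> w => t t0.
have Bu : forall M : R, exists2 s : R, 0 <= s & M < 1 * B s w.
  by near: w; apply: B_unb; left.
have Bd : forall M : R, exists2 s : R, 0 <= s & M < -1 * B s w.
  by near: w; apply: B_unb; right.
have xa : (@lebesgue_measure R).-negligible [set s | 0 <= s /\ X s w = a].
  by near: w; apply: null; left.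
have xb : (@lebesgue_measure R).-negligible [set s | 0 <= s /\ X s w = b].
  by near: w; apply: null; right.
apply: (@local_time_difference R a b (X^~ w) (B^~ w) (ga^~ w) (gb^~ w) (H^~ w)) => //.
- by near: w; exact: rbm_continuous X_rbm.
- by near: w; exact: rbm_range X_rbm.
- by near: w.
- by near: w; exact: rbm_local_time_a X_rbm.
- by near: w; exact: rbm_local_time_b X_rbm.
- by near: w; exact: rbm_skorokhod X_rbm.
- by move=> M; have [s s0 Bs] := Bu M; exists s; rewrite ?mul1r// in Bs *.
- by move=> M; have [s s0 Bs] := Bd (- M); exists s => //; lra.
- by near: w; exact: sub_start H_stable.
- by near: w; exact: sub_nondecreasing H_stable.
- by near: w; exact: stable_subordinator_unbounded H_stable.
- by move=> c [->|->].
Unshelve. all: by end_near. Qed.
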